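(* Let $(G,\tau)$ and $(H,\sigma)$ be topological groups, $L$ a normal subgroup of $G$, $f:(G,\tau)\to(H,\sigma)$ an A-open continuous surjective homomorphism, and $q:G\to G/L$, $q':H\to H/f(L)$ the canonical projections. Then the homomorphism $f'':G/L\to H/f(L)$ defined by $f''(q(g))=q'(f(g))$ for every $g\in G$, where $G/L$ and $H/f(L)$ carry the quotient topologies of $\tau$ and $\sigma$ respectively, is A-open.
   Context: Topological groups are not assumed Hausdorff. $\mathcal V_{(G,\tau)}(e_G)$ is the filter of all neighborhoods of $e_G$ in $(G,\tau)$. For a neighborhood $U$ of $e_G$, a subset $M\subseteq G$ is $U$-thin if $\bigcap\{x^{-1}Ux:x\in M\}$ is a neighborhood of $e_G$. Write $[x,y]=xyx^{-1}y^{-1}$ and, for $g\in G$ and $K\subseteq G$, $[g,K]=\{[g,k]:k\in K\}$. A homomorphism $f:(G,\tau)\to(H,\sigma)$ is A-open if for every $U\in\mathcal V_{(G,\tau)}(e_G)$: (a) there exists $V\in\mathcal V_{(H,\sigma)}(e_H)$ such that $f^{-1}(V)$ is $f^{-1}(f(U))$-thin; (b) for every $g\in G$ there exists $V_g\in\mathcal V_{(H,\sigma)}(e_H)$ such that $[g,f^{-1}(V_g)]\subseteq f^{-1}(f(U))$. *)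

(* Defs.v *)
From HB Require Import structures.
From mathcomp Require Import all_boot.
From mathcomp Require Import all_classical.
From mathcomp Require Import topology.

Set Implicit Arguments.
Unset Strict Implicit.
Unset Printing Implicit Defensive.

Local Open Scope classical_set_scope.
Local Open Scope quotient_scope.
Local Open Scope group_scope.

HB.mixin Record isTopologicalGroup G of Group G & Topological G := {
  mulg_continuous : continuous (fun x : G * G => x.1 * x.2) ;
  invg_continuous : continuous (fun x : G => x^-1)
}.

#[short(type="topologicalGroupType")]
HB.structure Definition TopologicalGroup :=
  {G of Group G & Topological G & isTopologicalGroup G}.

Record normalSubgroup (G : groupType) := NormalSubgroup {
  normalSubgroup_set :> set G ;
  normalSubgroup1 : normalSubgroup_set 1 ;
  normalSubgroupM : forall x y, normalSubgroup_set x ->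
    normalSubgroup_set y -> normalSubgroup_set (x * y) ;
  normalSubgroupV : forall x, normalSubgroup_set x ->
    normalSubgroup_set x^-1 ;
  normalSubgroupJ : forall x y, normalSubgroup_set x ->
    normalSubgroup_set (y * x * y^-1)
}.

Section ImageNormalSubgroup.
Context {G H : groupType} (f : {multiplicative G -> H}).
Hypothesis fsurj : set_surj setT setT f.

Fact mulg_morph1 : f 1 = 1.
Proof. by apply: (mulgI (f 1)); rewrite -gmulfM !mulg1. Qed.

Fact mulg_morphV x : f x^-1 = (f x)^-1.
Proof. by apply: (mulgI (f x)); rewrite -gmulfM !mulgV mulg_morph1. Qed.

Variable L : normalSubgroup G.

Fact image_normal1 : (f @` L) 1.
Proof. by exists 1; [exact: normalSubgroup1 | exact: mulg_morph1]. Qed.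

Fact image_normalM x y : (f @` L) x -> (f @` L) y -> (f @` L) (x * y).
Proof.
move=> [a La <-] [b Lb <-].
by exists (a * b); [exact: normalSubgroupM | rewrite gmulfM].
Qed.

Fact image_normalV x : (f @` L) x -> (f @` L) x^-1.
Proof.
by move=> [a La <-]; exists a^-1; [exact: normalSubgroupV | exact: mulg_morphV].
Qed.

Fact image_normalJ x y : (f @` L) x -> (f @` L) (y * x * y^-1).
Proof.
move=> [a La <-]; have [b _ <-] := fsurj (I : setT y).
exists (b * a * b^-1); first exact: normalSubgroupJ.
by rewrite !gmulfM mulg_morphV.
Qed.

Definition image_normalSubgroup : normalSubgroup H :=
  NormalSubgroup image_normal1 image_normalM image_normalV image_normalJ.

End ImageNormalSubgroup.

Section CosetRelation.
Context {G : groupType} (L : normalSubgroup G).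

Definition coset_rel : rel G := fun x y => `[< (L : set G) (x^-1 * y) >].

Fact coset_rel_refl : reflexive coset_rel.
Proof. by move=> x; apply/asboolP; rewrite mulVg; exact: normalSubgroup1. Qed.

Fact coset_rel_sym : symmetric coset_rel.
Proof.
have sub x y : coset_rel x y -> coset_rel y x.
  move=> /asboolP/normalSubgroupV; rewrite invgM invgK => Lyx.
  exact/asboolP.
by move=> x y; apply/idP/idP; exact: sub.
Qed.

Fact coset_rel_trans : transitive coset_rel.
Proof.
move=> y x z /asboolP Lxy /asboolP Lyz; apply/asboolP.
by move: (normalSubgroupM Lxy Lyz); rewrite -mulgA mulVKg.
Qed.

Canonical coset_equiv :=
  EquivRel coset_rel coset_rel_refl coset_rel_sym coset_rel_trans.

End CosetRelation.

Definition quotient_group (G : topologicalGroupType) (L : normalSubgroup G)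
  : Type := quotient_topology {eq_quot coset_equiv L}.

Section QuotientGroup.
Context {G : topologicalGroupType} (L : normalSubgroup G).
Local Notation Q := (quotient_group L).

HB.instance Definition _ := Topological.on Q.
HB.instance Definition _ := Quotient.on Q.

Definition quotient_pi : G -> Q := \pi_Q.

Local Notation q := quotient_pi.

Lemma quotient_piP x y : q x = q y <-> (L : set G) (x^-1 * y).
Proof.
split=> [/(@eqmodP _ (coset_equiv L))/asboolP//|Lxy].
by apply/(@eqmodP _ (coset_equiv L))/asboolP.
Qed.

Lemma quotient_reprK x : q (repr x) = x.
Proof. exact: reprK. Qed.

Definition quotient_mul (x y : Q) : Q := q (repr x * repr y).
Definition quotient_one : Q := q 1.
Definition quotient_inv (x : Q) : Q := q (repr x)^-1.

Lemma quotient_piM x y : quotient_mul (q x) (q y) = q (x * y).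
Proof.
set x' := repr (q x); set y' := repr (q y).
have /quotient_piP Lx : q x' = q x by exact: quotient_reprK.
have /quotient_piP Ly : q y' = q y by exact: quotient_reprK.
apply/quotient_piP; rewrite -/x' -/y'.
suff -> : (x' * y')^-1 * (x * y) =
    (y'^-1 * (x'^-1 * x) * y'^-1^-1) * (y'^-1 * y).
  by apply: normalSubgroupM => //; exact: normalSubgroupJ.
by rewrite invgK invgM !mulgA mulgK.
Qed.

Lemma quotient_piV x : quotient_inv (q x) = q x^-1.
Proof.
set x' := repr (q x).
have /quotient_piP Lx : q x = q x' by rewrite quotient_reprK.
apply/quotient_piP; rewrite -/x' invgK.
have -> : x' * x^-1 = x * (x^-1 * x') * x^-1 by rewrite mulgA mulgV mul1g.
exact: normalSubgroupJ.
Qed.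

Fact quotient_mulA : associative quotient_mul.
Proof.
move=> x y z; rewrite -(quotient_reprK x) -(quotient_reprK y).
by rewrite -(quotient_reprK z) !quotient_piM mulgA.
Qed.

Fact quotient_mul1 : left_id quotient_one quotient_mul.
Proof. by move=> x; rewrite -(quotient_reprK x) quotient_piM mul1g. Qed.

Fact quotient_1mul : right_id quotient_one quotient_mul.
Proof. by move=> x; rewrite -(quotient_reprK x) quotient_piM mulg1. Qed.

Fact quotient_mulV : left_inverse quotient_one quotient_inv quotient_mul.
Proof.
by move=> x; rewrite -(quotient_reprK x) quotient_piV quotient_piM mulVg.
Qed.

Fact quotient_Vmul : right_inverse quotient_one quotient_inv quotient_mul.
Proof.
by move=> x; rewrite -(quotient_reprK x) quotient_piV quotient_piM mulgV.
Qed.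

HB.instance Definition _ := isGroup.Build Q quotient_mulA quotient_mul1
  quotient_1mul quotient_mulV quotient_Vmul.

Fact quotient_pi_morph : {morph q : x y / x * y}.
Proof. by move=> x y; rewrite -quotient_piM. Qed.

HB.instance Definition _ := isMultiplicative.Build G Q q quotient_pi_morph.

Lemma quotient_pi_continuous : continuous q.
Proof. exact: pi_continuous. Qed.

Lemma mulgr_continuous (a : G) : continuous (fun x : G => x * a).
Proof.
move=> x; apply: (@continuous_comp _ _ _ (fun x => (x, a))
  (fun x : G * G => x.1 * x.2)); last exact: mulg_continuous.
by apply: cvg_pair; [exact: cvg_id | exact: cvg_cst].
Qed.

Lemma quotient_pi_open (U : set G) : open U -> open (q @` U).
Proof.
move=> oU; change (open (q @^-1` (q @` U))).
have -> : q @^-1` (q @` U) = \bigcup_(l in L) ((fun x => x * l) @^-1` U).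
  apply/seteqP; split=> [x [u Uu]|x [l Ll /= Uxl]].
    by move=> /esym/quotient_piP Lxu; exists (x^-1 * u); rewrite //= mulVKg.
  exists (x * l) => //; apply/quotient_piP.
  have -> : (x * l)^-1 * x = l^-1 by rewrite invgM -mulgA mulVg mulg1.
  exact: normalSubgroupV.
apply: bigcup_open => l _.
by apply: open_comp => // x _; exact: mulgr_continuous.
Qed.

Lemma quotient_pi_nbhs (x : G) (U : set G) :
  nbhs x U -> nbhs (q x) (q @` U).
Proof.
rewrite !nbhsE => -[V [oV Vx] VU]; exists (q @` V); last exact: image_subset.
by split; [exact: quotient_pi_open | exists x].
Qed.

Fact quotient_mul_continuous : continuous (fun x : Q * Q => x.1 * x.2).
Proof.
move=> [x y] U /=; rewrite -(quotient_reprK x) -(quotient_reprK y) -gmulfM.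
move: (repr x) (repr y) => a b /quotient_pi_continuous.
move=> /(@mulg_continuous G (a, b))[[A B] [/= Aa Bb] ABU].
exists (q @` A, q @` B); first by split; exact: quotient_pi_nbhs.
move=> [_ _] [/= [c Ac <-] [d Bd <-]].
by rewrite -[X in U X]gmulfM; exact: (ABU (c, d)).
Qed.

Fact quotient_inv_continuous : continuous (fun x : Q => x^-1).
Proof.
move=> x U; rewrite -(quotient_reprK x); move: (repr x) => a.
rewrite [(q a)^-1]quotient_piV => /quotient_pi_continuous.
move=> /(@invg_continuous G a) /quotient_pi_nbhs; apply: filterS.
by move=> _ [c Uc <-]; rewrite /= [(q c)^-1]quotient_piV.
Qed.

HB.instance Definition _ := isTopologicalGroup.Build Q
  quotient_mul_continuous quotient_inv_continuous.

End QuotientGroup.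

Section InducedMorphism.
Context {G H : topologicalGroupType} (f : {multiplicative G -> H}).
Context (fsurj : set_surj setT setT f) (L : normalSubgroup G).
Local Notation fL := (image_normalSubgroup fsurj L).

Definition quotient_map (x : quotient_group L) : quotient_group fL :=
  quotient_pi fL (f (repr x)).

Lemma quotient_mapE g :
  quotient_map (quotient_pi L g) = quotient_pi fL (f g).
Proof.
apply/quotient_piP; rewrite -mulg_morphV -gmulfM.
by apply: imageP; apply/quotient_piP; exact: quotient_reprK.
Qed.

Lemma quotient_map_unique (h : quotient_group L -> quotient_group fL) :
  (forall g, h (quotient_pi L g) = quotient_pi fL (f g)) -> h =1 quotient_map.
Proof. by move=> hE x; rewrite -(quotient_reprK x) hE quotient_mapE. Qed.

Fact quotient_map_morph : {morph quotient_map : x y / x * y}.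
Proof.
move=> x y; rewrite -(quotient_reprK x) -(quotient_reprK y) -gmulfM.
by rewrite !quotient_mapE !gmulfM.
Qed.

HB.instance Definition _ := isMultiplicative.Build _ _ quotient_map
  quotient_map_morph.

End InducedMorphism.

Arguments quotient_map {G H f} fsurj L x.

Definition thin (G : topologicalGroupType) (U M : set G) : Prop :=
  nbhs (1 : G) (\bigcap_(x in M) [set x^-1 * u * x | u in U]).

(* [x, y] = x y x^-1 y^-1, which differs from the library's [~ x, y]. *)
Definition commutator (G : groupType) (x y : G) : G := x * y * x^-1 * y^-1.

Definition A_open (G H : topologicalGroupType) (f : {multiplicative G -> H})
  : Prop :=
  forall U : set G, nbhs (1 : G) U ->
    (exists2 V : set H, nbhs (1 : H) V & thin (f @^-1` (f @` U)) (f @^-1` V)) /\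
    (forall g : G, exists2 V : set H, nbhs (1 : H) V &
      commutator g @` (f @^-1` V) `<=` f @^-1` (f @` U)).

(* Main.v *)
Require Import Defs.
From mathcomp Require Import all_boot.
From mathcomp Require Import all_classical.
From mathcomp Require Import topology.

(** Write [q : G -> G/L], [q' : H -> H/f(L)] and [f''] for the induced map. The
    two witnesses for [f''] and a neighborhood [U] of [1] in [G/L] are the images
    under [q'] of the witnesses for [f] and the neighborhood [q^-1(U)] of [1] in
    [G]. Two inclusions, which come from [f'' q = q' f], transfer the conditions:
    - [f''^-1(q'(V))] is contained in [q(f^-1(V))], as [q'] divides by [f(L)]
      only, so that the ambiguity it creates in [H] lifts to [L] and is killed by
      [q] ([quotient_map_preimage_sub]);
    - [q(f^-1(f(q^-1(U))))] is contained in [f''^-1(f''(U))]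
      ([image_saturation_sub]).
    Hence the elements of [G/L] to be tested are images under [q] of elements
    tested for [f], and the conclusions drawn in [G] map into the required set.
    For condition (a) the open homomorphism [q] moreover sends thin sets to thin
    sets ([thin_quotient]); for condition (b) it preserves commutators. *)

Local Open Scope classical_set_scope.
Local Open Scope group_scope.

Lemma thinS (G : topologicalGroupType) (U U' M M' : set G) :
  U `<=` U' -> M' `<=` M -> thin U M -> thin U' M'.
Proof.
move=> UU' MM'; rewrite /thin; apply: filterS => z Uz x M'x.
by have [u Uu <-] := Uz x (MM' x M'x); exists u => //; exact: UU'.
Qed.

(** Thinness passes to the quotient because the projection is open at the
    identity and conjugation commutes with it. *)
Lemma thin_quotient (G : topologicalGroupType) (L : normalSubgroup G)
    (U M : set G) :
  thin U M -> thin (quotient_pi L @` U) (quotient_pi L @` M).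
Proof.
rewrite /thin => /(quotient_pi_nbhs L); rewrite mulg_morph1.
apply: filterS => _ [z Uz <-] _ [x Mx <-].
have [u Uu <-] := Uz x Mx; exists (quotient_pi L u); first by exists u.
by rewrite !gmulfM mulg_morphV.
Qed.

Lemma commutator_morph (G H : groupType) (f : {multiplicative G -> H}) x y :
  f (commutator x y) = commutator (f x) (f y).
Proof. by rewrite /commutator !gmulfM !mulg_morphV. Qed.

Section InducedMap.
Context {G H : topologicalGroupType} (f : {multiplicative G -> H}).
Context (fsurj : set_surj setT setT f) (L : normalSubgroup G).
Local Notation fL := (image_normalSubgroup fsurj L).

(** If [q'(f x) = q'(v)] then [v] differs from [f x] by some [f l] with [l] in
    [L], so [x * l] represents the same coset as [x] and lies over [v]. *)
Lemma quotient_map_preimage_sub (V : set H) :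
  quotient_map fsurj L @^-1` (quotient_pi fL @` V) `<=`
  quotient_pi L @` (f @^-1` V).
Proof.
move=> y; rewrite -(quotient_reprK y); move: (repr y) => x [v Vv].
rewrite quotient_mapE => /esym/quotient_piP [l Ll flE].
exists (x * l); first by rewrite /preimage /= gmulfM flE mulVKg.
by apply/esym/quotient_piP; rewrite mulKg.
Qed.

Lemma image_saturation_sub (U : set (quotient_group L)) :
  quotient_pi L @` (f @^-1` (f @` (quotient_pi L @^-1` U))) `<=`
  quotient_map fsurj L @^-1` (quotient_map fsurj L @` U).
Proof.
move=> _ [w [u Uu fuw] <-]; exists (quotient_pi L u) => //.
by rewrite !quotient_mapE fuw.
Qed.

End InducedMap.

Theorem theorem6p14 (G H : topologicalGroupType) (L : normalSubgroup G)
  (f : {multiplicative G -> H}) (fsurj : set_surj setT setT f)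
  (fcont : continuous f) (fA : A_open f) :
  A_open (quotient_map fsurj L).
Proof.
move=> U U1.
have /fA [[V V1 thinV] commV] : nbhs (1 : G) (quotient_pi L @^-1` U).
  by apply: quotient_pi_continuous; rewrite mulg_morph1.
have pi'_nbhs (W : set H) : nbhs (1 : H) W ->
    nbhs 1 (quotient_pi (image_normalSubgroup fsurj L) @` W).
  by move=> /(quotient_pi_nbhs (image_normalSubgroup fsurj L));
     rewrite mulg_morph1.
split.
  exists (quotient_pi (image_normalSubgroup fsurj L) @` V); first exact: pi'_nbhs.
  apply: thinS (thin_quotient _ L _ _ thinV); first exact: image_saturation_sub.
  exact: quotient_map_preimage_sub.
move=> y; rewrite -(quotient_reprK y); move: (repr y) => g.
have [Vg Vg1 commVg] := commV g.
exists (quotient_pi (image_normalSubgroup fsurj L) @` Vg); first exact: pi'_nbhs.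
move=> _ [_ /quotient_map_preimage_sub [k Vgk <-] <-].
apply: image_saturation_sub; exists (commutator g k); last exact: commutator_morph.
by apply: commVg; exists k.
Qed.
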